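(* Let $p\in(0,1/2)$ and consider $\mathrm{nbBRW}(p)$ started from a finite number of particles. If there exist $\mu>0$ and $\alpha_1,\alpha_2,\alpha_3>0$ such that for $i=1,2,3$ $$\sum_{j=1}^{3} r_{ij}\,\alpha_j\left(p_j\frac1\mu+q_j\mu\right)\le\alpha_i,\qquad(\ast)$$ then $\mathbf E[V_{\mathrm{nbBRW}(p)}]<\infty$. Conversely, if $\mathbf E[V_{\mathrm{nbBRW}(p)}]<\infty$ for a finite initial configuration whose particles are not all located at $0$, then there exist $\mu>0$ and $\alpha_1,\alpha_2,\alpha_3>0$ such that $(\ast)$ holds with equality for $i=1,2,3$.
   Context: For $p\in(0,1/2)$ let $\hat p=p/(1-p)$. The non-backtracking $p$-biased branching random walk $\mathrm{nbBRW}(p)$ is a multitype branching random walk on $\mathbb Z_{\ge0}$ in discrete time with particle types $1,2,3$. At each time step each particle at a site $x\ge1$, independently of all others, produces offspring and dies immediately afterwards: a Type-1 particle produces either one Type-1 offspring (probability $\hat p$), or one Type-2 offspring plus a $\mathrm{Poi}(1)$-distributed number of Type-3 offspring (probability $1-\hat p$); a Type-2 particle produces one Type-2 offspring and a $\mathrm{Poi}(1)$-distributed number of Type-3 offspring with probability $1$; a Type-3 particle has the same offspring distribution as a Type-1 particle. Each newborn particle then displaces from its parent's site $x\geq 1$: Type-1 newborns move to $x-1$, while Type-2 and Type-3 newborns move to $x+1$. Particles that reach $0$ are stopped there forever and produce no offspring. $V_{\mathrm{nbBRW}(p)}$ is the total number of particles stopped (killed) at $0$. Here $r_{ij}$ is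 the expected number of Type-$j$ offspring of one Type-$i$ particle, i.e. $$R=(r_{ij})=\begin{bmatrix}\hat p&1-\hat p&1-\hat p\\0&1&1\\\hat p&1-\hat p&1-\hat p\end{bmatrix},$$ and $p_j$, $q_j$ are the probabilities that a newborn Type-$j$ particle moves one step left, respectively right: $p_1=q_2=q_3=1$ and $p_2=p_3=q_1=0$. *)

(* Defs.v *)
From HB Require Import structures.
From mathcomp Require Import all_boot all_order all_algebra finmap.
From mathcomp Require Import all_classical all_reals all_analysis.

Set Implicit Arguments.
Unset Strict Implicit.
Unset Printing Implicit Defensive.

Import Order.TTheory GRing.Theory Num.Theory.

Local Open Scope classical_set_scope.
Local Open Scope ring_scope.

Definition mutually_independent (R : realType) (d : measure_display)
    (T : measurableType d) (P : probability T R) (I : choiceType)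
    (d' : measure_display) (S : measurableType d') (X : I -> T -> S) : Prop :=
  forall (F : {fset I}) (A : I -> set S), (forall i, measurable (A i)) ->
    P (\bigcap_(i in [set` F]) X i @^-1` A i) =
    (\prod_(i <- F) P (X i @^-1` A i))%E.

(* Types 1, 2, 3 are the elements 0, 1, 2 of 'I_3. *)
Definition ptype : Type := 'I_3.
Definition type1 : ptype := @Ordinal 3 0 isT.
Definition type2 : ptype := @Ordinal 3 1 isT.
Definition type3 : ptype := @Ordinal 3 2 isT.

(* (n1, n2, n3): numbers of newborn particles of Types 1, 2, 3. *)
Definition offspring : Type := nat * nat * nat.

Definition phat (R : realType) (p : R) : R := p / (1 - p).

(* Probability that a particle of type i has offspring s. *)
Definition offspring_pmf (R : realType) (p : R) (i : ptype) (s : offspring) : R :=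
  match s with
  | (1, 0, 0)%N => if i == type2 then 0 else phat p
  | (0, 1, k)%N =>
      (if i == type2 then 1 else 1 - phat p) * poisson_pmf 1 k
  | _ => 0
  end.

(* Displacement of a newborn particle of type j whose parent is at x >= 1. *)
Definition displace (j : ptype) (x : nat) : nat :=
  if j == type1 then x.-1 else x.+1.

Definition newborns (s : offspring) (x : nat) : seq (ptype * nat) :=
  [seq (j, displace j x) |
    j <- nseq s.1.1 type1 ++ nseq s.1.2 type2 ++ nseq s.2 type3].

(* Particles carry Ulam-Harris labels: [:: k] is the k-th initial particle and
   k :: u is the k-th child of u, so that the particle labelled u is born at
   time (size u).-1. *)
Definition label : Type := seq nat.

(* xi (u, i) is the offspring of the particle labelled u in case it is of
   type i. *)
Definition is_nbBRW_offspring (R : realType) (p : R) (d : measure_display)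
    (T : measurableType d) (P : probability T R)
    (xi : label * ptype -> T -> offspring) : Prop :=
  [/\ forall ui, measurable_fun [set: T] (xi ui),
      forall u i s,
        P (xi (u, i) @^-1` [set s]) = (offspring_pmf p i s)%:E
    & mutually_independent P xi].

(* Type and site of the particle labelled u in the process with initial
   configuration init; None if no such particle is ever born. A particle at
   site 0 has no children: it is stopped there forever. *)
Fixpoint particle (T : Type) (init : seq (ptype * nat))
    (xi : label * ptype -> T -> offspring) (w : T) (u : label) :
    option (ptype * nat) :=
  match u with
  | [::] => None
  | [:: k] => onth init k
  | k :: v =>
      match particle init xi w v with
      | Some (i, x.+1) => onth (newborns (xi (v, i) w) x.+1) k
      | _ => None
      end
  end.

(* The total number of particles stopped at 0. *)
Definition V_nbBRW (R : realType) (T : Type) (init : seq (ptype * nat))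
    (xi : label * ptype -> T -> offspring) (w : T) : \bar R :=
  counting [set u : label | exists i, particle init xi w u = Some (i, 0%N)].

Definition mean_offspring (R : realType) (p : R) : 'M[R]_3 :=
  \matrix_(i < 3, j < 3)
    nth 0 (nth [::] [:: [:: phat p; 1 - phat p; 1 - phat p];
                        [:: 0;      1;          1         ];
                        [:: phat p; 1 - phat p; 1 - phat p]] i) j.

(* Probabilities that a newborn particle of type j moves left, resp. right. *)
Definition left_prob (R : realType) (j : ptype) : R := nth 0 [:: 1; 0; 0] j.
Definition right_prob (R : realType) (j : ptype) : R := nth 0 [:: 0; 1; 1] j.

(* Main.v *)
Require Import Defs.
From HB Require Import structures.
From mathcomp Require Import all_boot all_order all_algebra finmap.
From mathcomp Require Import all_classical all_reals all_analysis.
From mathcomp Require Import measurable_realfun ring lra.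

Set Implicit Arguments.
Unset Strict Implicit.
Unset Printing Implicit Defensive.

Import Order.TTheory GRing.Theory Num.Theory.

Local Open Scope classical_set_scope.
Local Open Scope ring_scope.

(** Write [h] for [phat p].  Everything reduces to the linear operator
    [mean_step p], which sends a weight [f] on (type, site) pairs to the mean
    total weight of the children of a particle; it is 0 at site 0.

    By the independence of the offspring variables, the mean total weight of
    generation [n] is the sum over the initial particles of the [n]-th iterate
    of the operator applied to [f] ([generation_mean_succ]).  For [f] the
    indicator of site 0 this gives [mean_V]: the mean of the number of stopped
    particles is the sum, over the initial particles [q], of
    [mean_stopped p q], the sum of the iterates at [q].

    If [mu] and [alpha] satisfy the inequalities, then a constant multiple of
    [alpha i * mu ^+ x] is a nonnegative function which is at least 1 at site
    0 and which the operator does not increase.  The partial sums defining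
    [mean_stopped p] stay below any such function
    ([mean_stopped_le_supersolution]), so the mean is finite.

    Conversely, suppose that [mean_stopped p] is finite at some positive site.
    Since particles of any type produce descendants of Type 2, which move
    right, it is finite at all sites far enough to the right.  There its
    values [a x] for Type 1, which are positive, satisfy
    [(2 - h) a (x + 2) - (1 + h) a (x + 1) + h a x = 0].  A recurrence of
    order two with complex characteristic roots has oscillating solutions, so
    positivity forces a nonnegative discriminant
    ([positive_recurrence_discriminant]); as [h < 1] this means [h <= 1 / 5],
    and the characteristic polynomial has a root [mu] in ]0, 1[.  With this
    [mu], the choice [alpha = (1 - mu, mu, 1 - mu)] turns the inequalities
    into equalities ([exact_solution]). *)

(** * Sums over countable types *)

Section Esum.
Context {R : realType}.
Local Open Scope ereal_scope.

Lemma esum_support (I J : choiceType) (e : I -> J) (f : J -> \bar R) :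
  injective e -> (forall j, (forall i, e i != j) -> f j = 0) ->
  \esum_(j in [set: J]) f j = \esum_(i in [set: I]) f (e i).
Proof.
move=> einj f0; rewrite -[RHS](esum_image setT e); last by move=> x y _ _; apply: einj.
rewrite [RHS]esum_mkcond; apply: eq_esum => j _; case: ifPn => // /negP je.
by apply: f0 => i; apply/eqP => eij; apply: je; rewrite inE; exists i.
Qed.

Lemma esum_delta (I : choiceType) (i0 : I) (f : I -> \bar R) :
  0 <= f i0 -> (forall i, i != i0 -> f i = 0) ->
  \esum_(i in [set: I]) f i = f i0.
Proof.
move=> f0 fN; rewrite -(@esum_set1 _ _ i0 f)// [RHS]esum_mkcond.
apply: eq_esum => i _; by case: ifPn => // /negP; rewrite inE/= => /eqP/fN ->.
Qed.

Lemma esum_pickle (I : countType) (f : I -> \bar R) : (forall i, 0 <= f i) ->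
  \esum_(i in [set: I]) f i = \sum_(n <oo) oapp f 0 (pickle_inv n).
Proof.
move=> f0; rewrite nneseries_esumT; last by move=> n; case: pickle_inv => /=.
rewrite (esum_support (e := @choice.pickle I)).
- by apply: eq_esum => i _; rewrite pickleK_inv.
- exact: pcan_inj pickleK_inv.
- move=> n nP; have := pickle_invK (T := I) n.
  by case: pickle_inv => //= i ei; have := nP i; rewrite ei eqxx.
Qed.

Lemma esumZl (I : countType) (c : R) (f : I -> \bar R) : (0 <= c)%R ->
  (forall i, 0 <= f i) ->
  \esum_(i in [set: I]) (c%:E * f i) = c%:E * \esum_(i in [set: I]) f i.
Proof.
move=> c0 f0; rewrite !esum_pickle//; last by move=> i; rewrite mule_ge0.
rewrite -nneseriesZl; last by move=> n _; case: pickle_inv => /=.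
by apply: eq_eseriesr => n _; case: pickle_inv => //=; rewrite mule0.
Qed.

Lemma esum_pair (I J : choiceType) (f : I -> J -> \bar R) :
  (forall i j, 0 <= f i j) ->
  \esum_(i in [set: I]) \esum_(j in [set: J]) f i j =
  \esum_(k in [set: I * J]) f k.1 k.2.
Proof.
move=> f0; rewrite esum_esum//; congr esum.
by apply/seteqP; split.
Qed.

Lemma esum_exchange (I J : choiceType) (f : I -> J -> \bar R) :
  (forall i j, 0 <= f i j) ->
  \esum_(i in [set: I]) \esum_(j in [set: J]) f i j =
  \esum_(j in [set: J]) \esum_(i in [set: I]) f i j.
Proof.
move=> f0; rewrite !esum_pair// (reindex_esum [set: J * I] _ (fun x => (x.2, x.1)))//.
by split=> [//|[? ?] [? ?] _ _ [-> ->]//|[i j] _]; exists (j, i).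
Qed.

(** The recursion on labels: a label is the root or a child of another label. *)
Lemma esum_seq (I : choiceType) (f : seq I -> \bar R) : (forall s, 0 <= f s) ->
  \esum_(s in [set: seq I]) f s =
  f [::] + \esum_(i in [set: I]) \esum_(s in [set: seq I]) f (i :: s).
Proof.
move=> f0; rewrite esum_pair//.
rewrite (@eq_esum _ _ _ _ (fun s => (if s is [::] then f [::] else 0) +
  (if s is [::] then 0 else f s))); last first.
  by move=> [|i s] _; rewrite ?adde0 ?add0e.
rewrite esumD//; [|by case..]; congr (_ + _).
  by rewrite (esum_delta (i0 := [::]))//; case.
rewrite (esum_support (e := fun k => k.1 :: k.2))//.
- by move=> [? ?] [? ?] /= [-> ->].
- by move=> [//|i s] /(_ (i, s)); rewrite eqxx.
Qed.

Lemma esum_onth (I : Type) (l : seq I) (f : I -> \bar R) : (forall i, 0 <= f i) ->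
  \esum_(k in [set: nat]) oapp f 0 (onth l k) = \sum_(i <- l) f i.
Proof.
move=> f0; rewrite -nneseries_esumT; last by move=> k; case: onth.
elim: l => [|i l IHl].
  by rewrite big_nil; apply: eseries0 => k _ _; rewrite onth0n.
rewrite nneseries_recl//; last by move=> k _; case: onth => /=.
rewrite big_cons -IHl -nneseries_addn; last by move=> k; case: onth => /=.
by under eq_eseriesr do rewrite addn1.
Qed.

Lemma counting_esum (I : choiceType) (A : set I) :
  counting A = \esum_(i in [set: I]) ((i \in A)%:R)%:E :> \bar R.
Proof.
transitivity (\esum_(i in A) 1%:E : \bar R); last first.
  by rewrite esum_mkcond; apply: eq_esum => i _; case: ifP.
rewrite /counting; case: ifPn => /asboolP Afin.
  rewrite esum_fset//.
  by rewrite fsbig_finite//= sumEFin big_const_seq count_predT iter_addr_0.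
apply/esym/eqyP => r r0.
have [B BA Bn] := infinite_set_fset (Num.trunc r).+1 Afin.
apply: esum_ge; exists [set` B] => //.
rewrite fsbig_finite//= set_fsetK sumEFin big_const_seq count_predT iter_addr_0 lee_fin.
apply: ltW; apply: lt_le_trans (truncnS_gt r) _.
by rewrite ler_nat.
Qed.

Lemma integral_esum d (T : measurableType d) (mu : {measure set T -> \bar R})
    (I : countType) (f : I -> T -> \bar R) :
  (forall i, measurable_fun [set: T] (f i)) -> (forall i w, 0 <= f i w) ->
  \int[mu]_w (\esum_(i in [set: I]) f i w) = \esum_(i in [set: I]) \int[mu]_w f i w.
Proof.
move=> mf f0; rewrite esum_pickle; last by move=> i; exact: integral_ge0.
under eq_integral do rewrite esum_pickle//.
rewrite (@integral_nneseries _ _ _ mu _ measurableT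
  (fun n w => oapp (f^~ w) 0 (pickle_inv n))).
- apply: eq_eseriesr => n _; case: pickle_inv => [i|]//=.
  by rewrite integral0.
- by move=> n; case: pickle_inv.
- by move=> n w _; case: pickle_inv => /=.
Qed.

Lemma measure_countable_bigcup d (T : measurableType d)
    (mu : {measure set T -> \bar R}) (I : countType) (A : I -> set T) :
  (forall i, measurable (A i)) -> trivIset setT A ->
  mu (\bigcup_i A i) = \esum_(i in [set: I]) mu (A i).
Proof.
move=> mA tA; rewrite esum_pickle//.
rewrite (_ : \bigcup_i A i = \bigcup_n oapp A set0 (pickle_inv n)); last first.
  apply/seteqP; split=> [w [i _ Aiw]|w [n _]].
    by exists (choice.pickle i) => //; rewrite pickleK_inv.
  by case: pickle_inv => // i /= ?; exists i.
rewrite measure_bigcup//.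
- rewrite [LHS]eseries_mkcond; apply: eq_eseriesr => n _; rewrite in_setT.
  by case: pickle_inv => //=.
- by move=> n _; case: pickle_inv => /=.
- apply/trivIsetP => m n _ _ mn; have := pickle_invK (T := I) m; have := pickle_invK (T := I) n.
  case: pickle_inv => [j|]/=; last by rewrite setI0.
  case: pickle_inv => [i|]/=; last by rewrite set0I.
  move=> ej ei; move/trivIsetP: tA; apply => //; apply: contra_neq mn => eij.
  by rewrite -ei -ej eij.
Qed.

End Esum.

(** * Independence of a particle and its offspring *)

Lemma measurable_offspring_set1 (s : offspring) : measurable [set s].
Proof.
case: s => [[a b] c].
rewrite (_ : [set _] = ([set a] `*` [set b]) `*` [set c]).
  by apply: measurableX => //; apply: measurableX.
by apply/seteqP; split=> [_ ->//|[[? ?] ?] [[/= -> ->] ->]].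
Qed.

Definition born_from (q : ptype * nat) (s : offspring) (k : nat)
    (c : ptype * nat) : bool :=
  (0 < q.2)%N && (onth (newborns s q.2) k == Some c).

Section Process.
Context {R : realType} {p : R} {d : measure_display} {T : measurableType d}
  {P : probability T R} {xi : label * ptype -> T -> offspring}.
Hypothesis hxi : is_nbBRW_offspring p P xi.
Variable init : seq (ptype * nat).
Local Open Scope ereal_scope.

Definition particle_at (u : label) (c : ptype * nat) : set T :=
  [set w | particle init xi w u = Some c].

(** The parent [v] is at [qs.1] and has offspring [qs.2], whose [k]-th member
    is [c]. *)
Definition birth_event (k : nat) (v : label) (c : ptype * nat)
    (qs : (ptype * nat) * offspring) : set T :=
  if born_from qs.1 qs.2 k c
  then particle_at v qs.1 `&` xi (v, qs.1.1) @^-1` [set qs.2] else set0.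

Definition cylinder (F : {fset label * ptype})
    (A : label * ptype -> set offspring) : set T :=
  \bigcap_(i in [set` F]) xi i @^-1` A i.

Lemma particle_at_cons k v c : v != [::] ->
  particle_at (k :: v) c = \bigcup_qs birth_event k v c qs.
Proof.
move=> v0; have E w : particle init xi w (k :: v) =
    if particle init xi w v is Some (i, x.+1)
    then onth (newborns (xi (v, i) w) x.+1) k else None by case: v v0.
apply/seteqP; split=> [w|w [[[i x] s] _]]; rewrite /particle_at /birth_event /mkset E /=.
  case Ev: (particle init xi w v) => [[i [|x]]|]// Hc.
  exists ((i, x.+1), xi (v, i) w) => //=.
  by rewrite /born_from/= Hc eqxx /=.
rewrite /born_from/=; case: ifPn => //= /andP[]; case: x => // x _ /eqP Hc [-> /= ->].
exact: Hc.
Qed.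

Lemma trivIset_birth_event k v c : trivIset setT (birth_event k v c).
Proof.
move=> -[q s] [q' s'] _ _ [w []]; rewrite /birth_event/=.
case: ifP => // _ [+ Es]; case: ifP => // _ + [+ Es'].
rewrite /particle_at/= => -> [qq']; move: Es Es'; rewrite -qq' /= => -> ->.
by [].
Qed.

Lemma measurable_xi i s : measurable (xi i @^-1` [set s]).
Proof.
have [mxi _ _] := hxi; rewrite -[X in measurable X]setTI.
exact: mxi measurableT _ (measurable_offspring_set1 s).
Qed.

Lemma measurable_particle_at v c : measurable (particle_at v c).
Proof.
elim: v c => [|k v IHv] c; first by rewrite (_ : particle_at _ _ = set0)//; apply/seteqP; split.
have [->|v0] := eqVneq v [::].
  by rewrite /particle_at/=; case: (pselect (onth init k = Some c)) => h;
    [rewrite (_ : [set _ | _] = setT)//|rewrite (_ : [set _ | _] = set0)//];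
    apply/seteqP; split.
rewrite particle_at_cons//; apply: countable_bigcupT_measurable => [|[q s]]; first exact: countableP.
rewrite /birth_event/=; case: ifP => // _.
by apply: measurableI => //; exact: measurable_xi.
Qed.

Lemma measurable_birth_event k v c qs : measurable (birth_event k v c qs).
Proof.
rewrite /birth_event; case: ifP => // _.
apply: measurableI; [exact: measurable_particle_at|exact: measurable_xi].
Qed.

Lemma measurable_cylinder F A : (forall i, measurable (A i)) ->
  measurable (cylinder F A).
Proof.
move=> mA; apply: fin_bigcap_measurable => // i _.
have [mxi _ _] := hxi; rewrite -[X in measurable X]setTI.
exact: mxi.
Qed.

Lemma cylinder0 A : cylinder fset0 A = setT.
Proof. by apply/seteqP; split=> // w _ i. Qed.

Definition pinned (A : label * ptype -> set offspring) ui s :=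
  fun i => if i == ui then [set s] else A i.

Lemma measurable_pinned A ui s i : (forall i, measurable (A i)) ->
  measurable (pinned A ui s i).
Proof.
by move=> mA; rewrite /pinned; case: ifP => // _; exact: measurable_offspring_set1.
Qed.

Lemma cylinder_pinned F A ui s : ui \notin F ->
  cylinder (ui |` F)%fset (pinned A ui s) =
  xi ui @^-1` [set s] `&` cylinder F A.
Proof.
move=> uiF; have neq i : i \in F -> (i == ui) = false.
  by move=> iF; apply: contraNF uiF => /eqP <-.
apply/seteqP; split=> [w h|w [h1 h2] i /=]; rewrite /pinned.
  split=> [|i iF].
    by have := h ui; rewrite /= /pinned eqxx; apply; rewrite !inE eqxx.
  have := h i; rewrite /= /pinned neq//; apply.
  by rewrite !inE iF orbT.
rewrite !inE => /orP[/eqP->|iF]; first by rewrite eqxx.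
by rewrite neq//; exact: h2.
Qed.

Lemma prob_cylinder_pinned F A ui s : (forall i, measurable (A i)) ->
  ui \notin F ->
  P (xi ui @^-1` [set s] `&` cylinder F A) =
  P (xi ui @^-1` [set s]) * P (cylinder F A).
Proof.
move=> mA uiF; have [_ _ ind] := hxi.
rewrite -cylinder_pinned// /cylinder !ind//; last by move=> i; exact: measurable_pinned.
rewrite big_fsetU1//= {1}/pinned eqxx; congr (_ * _).
apply: eq_big_seq => i iF; rewrite /pinned ifN//.
by apply: contraNneq uiF => <-.
Qed.

(** The position of [v] is determined by the offspring of its strict
    ancestors, whose labels are shorter than [v].  The induction on [v] needs
    an arbitrary finite set of constraints on labels at least as long as [v]:
    decomposing on the position and the offspring of the parent adds one
    constraint at the label of the parent. *)
Lemma particle_at_indep v c (F : {fset label * ptype})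
    (A : label * ptype -> set offspring) : (forall i, measurable (A i)) ->
  (forall ui, ui \in F -> (size v <= size ui.1)%N) ->
  P (particle_at v c `&` cylinder F A) = P (particle_at v c) * P (cylinder F A).
Proof.
elim: v c F A => [|k v IHv] c F A mA sF.
  rewrite (_ : particle_at _ _ = set0) ?set0I ?measure0 ?mul0e//.
  by apply/seteqP; split.
have [->|v0] := eqVneq v [::].
  rewrite /particle_at/=; case: (pselect (onth init k = Some c)) => h.
    rewrite (_ : [set _ | _] = setT) ?setTI ?probability_setT ?mul1e//.
    by apply/seteqP; split.
  rewrite (_ : [set _ | _] = set0) ?set0I ?measure0 ?mul0e//.
  by apply/seteqP; split.
have mC := measurable_cylinder F mA.
have pC : P (cylinder F A) = (fine (P (cylinder F A)))%:E.
  by rewrite fineK// fin_num_measure.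
have branch qs : P (birth_event k v c qs `&` cylinder F A) =
    P (cylinder F A) * P (birth_event k v c qs).
  case: qs => q s; rewrite /birth_event/=; case: ifP => _; last first.
    by rewrite set0I measure0 mule0.
  (* Labels in F are strictly longer than v, so the constraint at v is new. *)
  have vF : (v, q.1) \notin F by apply/negP => /sF /=; rewrite ltnn.
  have step F' : (v, q.1) \notin F' -> {subset F' <= F} ->
      P (particle_at v q `&` (xi (v, q.1) @^-1` [set s] `&` cylinder F' A)) =
      P (particle_at v q) * (P (xi (v, q.1) @^-1` [set s]) * P (cylinder F' A)).
    move=> vF' F'F; rewrite -prob_cylinder_pinned// -cylinder_pinned// IHv//.
      by move=> i; exact: measurable_pinned.
    by move=> ui; rewrite !inE => /orP[/eqP->//|/F'F/sF/ltnW].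
  rewrite -setIA step//; have := step fset0.
  rewrite cylinder0 setIT probability_setT mule1 => ->//.
  by rewrite muleA muleC.
rewrite particle_at_cons// setI_bigcupl.
have mB := measurable_birth_event k v c; have tB := @trivIset_birth_event k v c.
rewrite (measure_countable_bigcup _ _ tB)// measure_countable_bigcup//; first last.
- exact: trivIset_setIr.
- by move=> i; exact: measurableI.
transitivity (\esum_(qs in [set: (ptype * nat) * offspring])
    (P (cylinder F A) * P (birth_event k v c qs))).
  by apply: eq_esum => qs _; exact: branch.
by rewrite pC esumZl// 1?muleC// fine_ge0.
Qed.

Lemma offspring_pmf_ge0 i s : (0 <= offspring_pmf p i s)%R.
Proof. by have [_ pxi _] := hxi; rewrite -lee_fin -(pxi [::]). Qed.

Lemma prob_particle_at_cons k v c : v != [::] ->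
  P (particle_at (k :: v) c) =
  \esum_(q in [set: ptype * nat]) (P (particle_at v q) *
    \esum_(s in [set: offspring])
      ((born_from q s k c)%:R * offspring_pmf p q.1 s)%:E).
Proof.
move=> v0; rewrite particle_at_cons// measure_countable_bigcup; last first.
- exact: trivIset_birth_event.
- by move=> i; exact: measurable_birth_event.
have [_ pxi _] := hxi; have pmf0 := offspring_pmf_ge0.
transitivity (\esum_(qs in [set: (ptype * nat) * offspring])
    (P (particle_at v qs.1) *
       ((born_from qs.1 qs.2 k c)%:R * offspring_pmf p qs.1.1 qs.2)%:E)).
  apply: eq_esum => -[q s] _; rewrite /birth_event/=.
  case: ifP => _; last by rewrite mul0r mule0 measure0.
  have := @particle_at_indep v q fset0 (fun=> setT).
  have := @particle_at_indep v q [fset (v, q.1)]%fset (fun=> [set s]).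
  rewrite /cylinder set_fset1 bigcap_set1 => ->//.
  - by rewrite pxi mul1r.
  - by move=> _; exact: measurable_offspring_set1.
  - by move=> ui; rewrite inE => /eqP->.
rewrite -(@esum_pair _ _ _ (fun q s => P (particle_at v q) *
       ((born_from q s k c)%:R * offspring_pmf p q.1 s)%:E)).
  apply: eq_esum => q _; rewrite -[P _]fineK; last first.
    by rewrite fin_num_measure//; exact: measurable_particle_at.
  by rewrite esumZl ?fine_ge0// => s; rewrite lee_fin mulr_ge0.
by move=> q s; rewrite mule_ge0// lee_fin mulr_ge0.
Qed.

End Process.

(** * The mean operator *)

Lemma sum_ptype (V : nmodType) (g : ptype -> V) :
  \sum_(j < 3) g j = g type1 + g type2 + g type3.
Proof.
rewrite !big_ord_recl big_ord0 addr0 addrA.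
by congr (g _ + g _ + g _); apply/val_inj.
Qed.

Lemma ptypeP (Q : ptype -> Prop) : Q type1 -> Q type2 -> Q type3 -> forall i, Q i.
Proof.
move=> Q1 Q2 Q3 [[|[|[|//]]] hi].
- by rewrite (_ : Ordinal hi = type1)//; exact: val_inj.
- by rewrite (_ : Ordinal hi = type2)//; exact: val_inj.
- by rewrite (_ : Ordinal hi = type3)//; exact: val_inj.
Qed.

Section MeanOffspring.
Context {R : realType} (p : R).
Hypothesis hp : 0 < p < 1 / 2.

Lemma phat_bounds : 0 < phat p < 1.
Proof.
have /andP[p0 p2] := hp; rewrite /phat; apply/andP; split; first by apply: divr_gt0; lra.
by rewrite ltr_pdivrMr; lra.
Qed.

Lemma mean_offspringE i : [/\
  mean_offspring p i type1 = if i == type2 then 0 else phat p,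
  mean_offspring p i type2 = if i == type2 then 1 else 1 - phat p &
  mean_offspring p i type3 = if i == type2 then 1 else 1 - phat p].
Proof. by move: i; apply: ptypeP; rewrite !mxE. Qed.

Lemma mean_offspring_ge0 i j : 0 <= mean_offspring p i j.
Proof.
have /andP[h0 h1] := phat_bounds; have [E1 E2 E3] := mean_offspringE i.
by move: j; apply: ptypeP; rewrite ?E1 ?E2 ?E3; case: ifP => // _; lra.
Qed.

(** Mean total weight of the children of a particle at [q], where [f] gives the
    weights.  A particle at site 0 has no children. *)
Definition mean_step (f : ptype * nat -> R) (q : ptype * nat) : R :=
  if q.2 is x.+1
  then \sum_(j < 3) mean_offspring p q.1 j * f (j, displace j x.+1) else 0.

Lemma esum_poisson1 : (\esum_(k in [set: nat]) (poisson_pmf (1 : R) k)%:E = 1)%E.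
Proof. by have := probability_setT (poisson_prob (1 : R) 0); rewrite /= /poisson_prob ltr01. Qed.

(** Shifting [k] turns [k / k`!] into the Poisson weights again. *)
Lemma mean_poisson1 :
  (\esum_(k in [set: nat]) (poisson_pmf (1 : R) k * k%:R)%:E = 1)%E.
Proof.
rewrite -nneseries_esumT; last first.
  by move=> k; rewrite lee_fin mulr_ge0 ?poisson_pmf_ge0.
rewrite nneseries_recl//; last first.
  by move=> k; rewrite lee_fin mulr_ge0 ?poisson_pmf_ge0.
rewrite mulr0 add0e -nneseries_addn; last first.
  by move=> k; rewrite lee_fin mulr_ge0 ?poisson_pmf_ge0.
rewrite -esum_poisson1 -nneseries_esumT; last first.
  by move=> k; rewrite lee_fin poisson_pmf_ge0.
apply: eq_eseriesr => k _; congr EFin; rewrite addn1 /poisson_pmf ltr01.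
rewrite !expr1n factS natrM.
have : k.+1%:R != 0 :> R by rewrite pnatr_eq0.
have : k`!%:R != 0 :> R by rewrite pnatr_eq0 -lt0n fact_gt0.
move: (k.+1%:R) (k`!%:R) => a b b0 a0.
by field; rewrite a0 b0.
Qed.

Lemma sum_newborns (f : ptype * nat -> R) s x :
  \sum_(c <- newborns s x) f c =
    s.1.1%:R * f (type1, displace type1 x) +
    s.1.2%:R * f (type2, displace type2 x) +
    s.2%:R * f (type3, displace type3 x).
Proof.
rewrite /newborns big_map !big_cat !big_nseq /= !iter_addr_0.
by rewrite addrA !mulr_natl.
Qed.

(** The offspring law is carried by the singleton [(1, 0, 0)] and by the
    triples [(0, 1, k)] with a Poisson distributed [k], so that the sum over all
    triples splits into one term and one series over [k]. *)
Lemma mean_newborns (f : ptype * nat -> R) i x : (forall q, 0 <= f q) ->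
  (\esum_(s in [set: offspring])
     (offspring_pmf p i s * \sum_(c <- newborns s x) f c)%:E =
  (\sum_(j < 3) mean_offspring p i j * f (j, displace j x))%:E)%E.
Proof.
move=> f0; have /andP[h0 h1] := phat_bounds.
pose c1 := if i == type2 then 0 else phat p.
pose c2 := if i == type2 then 1 else 1 - phat p.
have c10 : 0 <= c1 by rewrite /c1; case: ifP => // _; lra.
have c20 : 0 <= c2 by rewrite /c2; case: ifP => // _; lra.
rewrite sum_ptype; have [-> -> ->] := mean_offspringE i; rewrite -/c1 -/c2.
set F1 := f (type1, _); set F2 := f (type2, _); set F3 := f (type3, _).
pose g (s : offspring) : \bar R := (if s is (0, 1, k)%N
  then c2 * (poisson_pmf 1 k * F2 + poisson_pmf 1 k * k%:R * F3) else 0)%:E.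
pose g1 (s : offspring) : \bar R := (if s == (1, 0, 0)%N then c1 * F1 else 0)%:E.
have g0 s : (0 <= g s)%E.
  rewrite lee_fin; case: s => [[[|//] [//|[|//]]] k].
  by rewrite !(mulr_ge0, addr_ge0) ?poisson_pmf_ge0 ?f0.
have g10 s : (0 <= g1 s)%E by rewrite lee_fin; case: ifP => // _; rewrite mulr_ge0 ?f0.
rewrite (@eq_esum _ _ _ _ (fun s => g1 s + g s)%E); last first.
  move=> s _; rewrite -EFinD sum_newborns -/F1 -/F2 -/F3; congr EFin.
  by move: s => [[[|[|a]] [|[|b]]] [|k]] /=; rewrite -/c1 -/c2; ring.
rewrite esumD//.
rewrite (esum_delta (i0 := (1, 0, 0)%N))//; last by move=> s /negbTE; rewrite /g1 => ->.
rewrite (esum_support (e := fun k => (0, 1, k)%N)); first last.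
- by move=> [[[|//] [//|[|//]]] k] /(_ k); rewrite eqxx.
- by move=> ? ? [].
rewrite /g; under eq_esum do rewrite EFinM.
rewrite esumZl//; last first.
  by move=> k; rewrite lee_fin !(mulr_ge0, addr_ge0) ?poisson_pmf_ge0 ?f0.
under eq_esum do rewrite EFinD.
rewrite esumD; [|by move=> k _; rewrite lee_fin !mulr_ge0 ?poisson_pmf_ge0 ?f0..].
have Zr (w : nat -> R) F : (forall k, 0 <= w k) -> 0 <= F ->
    (\esum_(k in [set: nat]) (w k * F)%:E =
     F%:E * \esum_(k in [set: nat]) (w k)%:E)%E.
  move=> w0 F0; rewrite -esumZl//.
  by apply: eq_esum => k _; rewrite mulrC EFinM.
have pk0 k : 0 <= poisson_pmf (1 : R) k * k%:R by rewrite mulr_ge0 ?poisson_pmf_ge0.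
rewrite (Zr _ _ (poisson_pmf_ge0 1) (f0 _)).
rewrite (Zr _ _ pk0 (f0 _)).
rewrite esum_poisson1 mean_poisson1 /g1 eqxx !mule1 -!EFinD; congr EFin.
by rewrite -/F2 -/F3 mulrDr addrA.
Qed.

Lemma mean_step_ge0 (f : ptype * nat -> R) : (forall q, 0 <= f q) -> forall q, 0 <= mean_step f q.
Proof.
move=> f0 [i [|x]]; rewrite /mean_step//=.
by apply: sumr_ge0 => j _; rewrite mulr_ge0// mean_offspring_ge0.
Qed.

Definition at_origin (q : ptype * nat) : R := (q.2 == 0%N)%:R.

Lemma iter_mean_step_ge0 n q : 0 <= iter n mean_step at_origin q.
Proof.
elim: n q => [q|n IHn]; first by rewrite /= /at_origin.
by rewrite iterS; exact: mean_step_ge0.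
Qed.

(** The mean number of particles stopped at 0 that descend from one particle
    at [q]: the [n]-th term counts those of generation [n] (see [mean_V]). *)
Definition mean_stopped (q : ptype * nat) : \bar R :=
  (\sum_(n <oo) (iter n mean_step at_origin q)%:E)%E.

End MeanOffspring.

(** * The mean number of stopped particles *)

Section Generations.
Context {R : realType} {p : R} {d : measure_display} {T : measurableType d}
  {P : probability T R} {xi : label * ptype -> T -> offspring}.
Hypothesis hp : (0 < p < 1 / 2)%R.
Hypothesis hxi : is_nbBRW_offspring p P xi.
Variable init : seq (ptype * nat).
Local Open Scope ereal_scope.
Local Notation particle_at := (particle_at (xi := xi) init).
Implicit Types (f : ptype * nat -> R) (u v : label).

Definition particle_mean f u : \bar R :=
  \esum_(c in [set: ptype * nat]) (P (particle_at u c) * (f c)%:E).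

(** Particles of generation [n] have labels of size [n.+1], the initial ones
    having labels of size 1. *)
Definition generation_mean n f : \bar R :=
  \esum_(u in [set: label]) (if size u == n.+1 then particle_mean f u else 0).

Let P_ge0 u c : 0 <= P (particle_at u c).
Proof. exact: measure_ge0. Qed.

Let P_fine u c : P (particle_at u c) = (fine (P (particle_at u c)))%:E.
Proof. by rewrite fineK// fin_num_measure//; exact: (measurable_particle_at hxi). Qed.

Lemma particle_mean_ge0 f u : (forall q, (0 <= f q)%R) -> 0 <= particle_mean f u.
Proof. by move=> f0; apply: esum_ge0 => c _; rewrite mule_ge0// lee_fin. Qed.

(** Each index [k] below the number of newborns contributes its newborn once. *)
Lemma esum_born_from f q s : (forall q, (0 <= f q)%R) ->
  \esum_(k in [set: nat]) \esum_(c in [set: ptype * nat])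
    ((born_from q s k c)%:R * f c)%:E =
  (if q.2 is x.+1 then \sum_(c <- newborns s x.+1) f c else 0)%:E.
Proof.
move=> f0; rewrite -[RHS](_ : (if (0 < q.2)%N then
    \sum_(c <- newborns s q.2) (f c)%:E else 0) = _); last first.
  by case: q => i [|x]//=; rewrite sumEFin.
rewrite /born_from; case: ifP => q0; last first.
  by rewrite esum1// => k _; rewrite esum1// => c _; rewrite mul0r.
rewrite -(@esum_onth _ _ _ (fun c => (f c)%:E))//; apply: eq_esum => k _ /=.
case E: onth => [c|] /=; last by rewrite esum1// => c _; rewrite mul0r.
rewrite (esum_delta (i0 := c)) ?eqxx ?mul1r// ?lee_fin// => c' c'c.
rewrite (_ : (_ == _) = false) ?mul0r//.
by apply: contra_neqF c'c => /eqP[].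
Qed.

(** Condition on the position [q] and the offspring [s] of [v]: by independence
    their joint law is a product, and the nonnegative sums over [k], [c], [q]
    and [s] may be taken in any order. *)
Lemma particle_mean_children f v : (forall q, (0 <= f q)%R) -> v != [::] ->
  \esum_(k in [set: nat]) particle_mean f (k :: v) =
  particle_mean (mean_step p f) v.
Proof.
move=> f0 v0.
pose X q k c s : \bar R := ((born_from q s k c)%:R * offspring_pmf p q.1 s * f c)%:E.
have X0 q k c s : 0 <= X q k c s.
  by rewrite lee_fin !mulr_ge0 ?(offspring_pmf_ge0 hxi).
have XX0 q k c : 0 <= \esum_(s in [set: offspring]) X q k c s by exact: esum_ge0.
have XXX0 q k : 0 <= \esum_(c in [set: ptype * nat])
  \esum_(s in [set: offspring]) X q k c s by exact: esum_ge0.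
have PX0 q k c : 0 <= P (particle_at v q) * \esum_(s in [set: offspring]) X q k c s.
  by rewrite mule_ge0.
transitivity (\esum_(k in [set: nat]) \esum_(c in [set: ptype * nat])
    \esum_(q in [set: ptype * nat]) (P (particle_at v q) *
      \esum_(s in [set: offspring]) X q k c s)).
  apply: eq_esum => k _; apply: eq_esum => c _.
  rewrite (prob_particle_at_cons hxi)// muleC -esumZl//; last first.
    move=> q; rewrite mule_ge0// esum_ge0// => s _.
    by rewrite lee_fin mulr_ge0 ?(offspring_pmf_ge0 hxi).
  apply: eq_esum => q _; rewrite muleCA -esumZl//; last first.
    by move=> s; rewrite lee_fin mulr_ge0 ?(offspring_pmf_ge0 hxi).
  by congr (_ * _); apply: eq_esum => s _; rewrite muleC -EFinM.
under eq_esum do rewrite esum_exchange//.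
rewrite esum_exchange; last by move=> k q; exact: esum_ge0.
apply: eq_esum => q _.
transitivity (P (particle_at v q) * \esum_(k in [set: nat])
    \esum_(c in [set: ptype * nat]) \esum_(s in [set: offspring]) X q k c s).
  rewrite P_fine -esumZl// ?fine_ge0//; apply: eq_esum => k _.
  by rewrite -esumZl// fine_ge0.
congr (_ * _).
under eq_esum do rewrite esum_exchange//.
rewrite esum_exchange; last by move=> k s; exact: esum_ge0.
transitivity (\esum_(s in [set: offspring]) (offspring_pmf p q.1 s *
    if q.2 is x.+1 then \sum_(c <- newborns s x.+1) f c else 0)%:E).
  apply: eq_esum => s _; rewrite EFinM -esum_born_from//.
  rewrite -esumZl ?(offspring_pmf_ge0 hxi)//; last first.
    by move=> k; apply: esum_ge0 => c _; rewrite lee_fin mulr_ge0.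
  apply: eq_esum => k _; rewrite -esumZl ?(offspring_pmf_ge0 hxi)//; last first.
    by move=> c; rewrite lee_fin mulr_ge0.
  by apply: eq_esum => c _; rewrite -EFinM mulrCA mulrA.
rewrite /mean_step; case: q.2 => [|x]; last exact: mean_newborns.
by rewrite esum1// => s _; rewrite mulr0.
Qed.

Lemma generation_mean_succ n f : (forall q, (0 <= f q)%R) ->
  generation_mean n.+1 f = generation_mean n (mean_step p f).
Proof.
move=> f0; rewrite /generation_mean.
have ge0 m u : 0 <= if size u == m then particle_mean f u else 0.
  by case: ifP => // _; exact: particle_mean_ge0.
rewrite esum_seq//= add0e esum_exchange; last by move=> k v; exact: (ge0 n.+2 (k :: v)).
apply: eq_esum => v _; rewrite eqSS; case: ifP => [/eqP sv|_]; last by rewrite esum1.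
by rewrite particle_mean_children// -size_eq0 sv.
Qed.

Lemma generation_mean0 f : (forall q, (0 <= f q)%R) ->
  generation_mean 0 f = \sum_(q <- init) (f q)%:E.
Proof.
move=> f0; rewrite /generation_mean.
have ge0 m u : 0 <= if size u == m then particle_mean f u else 0.
  by case: ifP => // _; exact: particle_mean_ge0.
rewrite esum_seq//= add0e -esum_onth//; apply: eq_esum => k _.
rewrite (esum_delta (i0 := [::]))//=; first last.
- by case.
- exact: particle_mean_ge0.
rewrite /particle_mean /particle_at/=; case: onth => [q|]/=; last first.
  rewrite esum1// => c _; rewrite (_ : [set _ | _] = set0) ?measure0 ?mul0e//.
  by apply/seteqP; split.
rewrite (esum_delta (i0 := q)).
- rewrite (_ : [set _ | _] = setT) ?probability_setT ?mul1e//.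
  by apply/seteqP; split.
- by rewrite mule_ge0// lee_fin.
- move=> c cq; rewrite (_ : [set _ | _] = set0) ?measure0 ?mul0e//.
  by apply/seteqP; split=> // w [] /esym/eqP; rewrite (negbTE cq).
Qed.

Lemma generation_mean_origin n :
  generation_mean n at_origin = \sum_(q <- init) (iter n (mean_step p) at_origin q)%:E.
Proof.
suff H f : (forall q, (0 <= f q)%R) ->
    generation_mean n f = \sum_(q <- init) (iter n (mean_step p) f q)%:E.
  by apply: H => q; rewrite /at_origin.
elim: n f => [|n IHn] f f0; first exact: generation_mean0.
rewrite generation_mean_succ// IHn; last exact: (mean_step_ge0 hp).
by rewrite iterSr.
Qed.

(** The number of stopped particles is the sum over all labels of the indicators
    that the particle with this label is at 0; integrate term by term and group
    the labels by their size. *)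
Lemma mean_V : \int[P]_w V_nbBRW R init xi w = \sum_(q <- init) mean_stopped p q.
Proof.
pose stopped u := \bigcup_(i : ptype) particle_at u (i, 0%N).
have mstopped u : measurable (stopped u).
  apply: countable_bigcupT_measurable; first exact: countableP.
  by move=> i; exact: (measurable_particle_at hxi).
have Pstopped u : P (stopped u) = particle_mean at_origin u.
  rewrite measure_countable_bigcup; first last.
  - by move=> i j _ _ [w []]; rewrite /particle_at/= => -> [].
  - by move=> i; exact: (measurable_particle_at hxi).
  rewrite /particle_mean (esum_support (e := fun i : ptype => (i, 0%N))).
  - by apply: eq_esum => i _; rewrite /at_origin /= mule1.
  - by move=> i j [].
  - by move=> [i [|x]] /(_ i); rewrite ?eqxx// => _; rewrite /at_origin mule0.
have om0 q : (0 <= at_origin q :> R)%R by rewrite /at_origin.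
have pm0 u := particle_mean_ge0 u om0.
transitivity (\int[P]_w \esum_(u in [set: label]) (\1_(stopped u) w)%:E).
  apply: eq_integral => w _; rewrite /V_nbBRW counting_esum.
  apply: eq_esum => u _; rewrite indicE; congr ((nat_of_bool _)%:R)%:E.
  apply/idP/idP; rewrite !inE => -[i]; last by move=> _; exists i.
  by exists i.
rewrite integral_esum => [| |u w]; first last.
- by rewrite lee_fin.
- move=> u; apply/measurable_EFinP; exact: measurable_indic.
transitivity (\esum_(u in [set: label]) particle_mean at_origin u).
  apply: eq_esum => u _; rewrite integral_indic// setIT; exact: Pstopped.
transitivity (\sum_(n <oo) generation_mean n at_origin).
  have g0 n u : 0 <= if size u == n.+1 then particle_mean at_origin u else 0.
    by case: ifP.
  rewrite nneseries_esumT; last by move=> n; apply: esum_ge0 => u _; exact: g0.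
  rewrite /generation_mean [RHS]esum_exchange//.
  apply: eq_esum => -[|k v] _.
    rewrite [RHS]esum1// /particle_mean esum1// => c _.
    by rewrite (_ : particle_at _ _ = set0) ?measure0 ?mul0e//; apply/seteqP; split.
  rewrite (esum_delta (i0 := size v)) ?eqxx// => n nv.
  by rewrite ifN// eqSS eq_sym.
under eq_eseriesr do rewrite generation_mean_origin.
by rewrite nneseries_sum// => q n _; rewrite lee_fin (iter_mean_step_ge0 hp).
Qed.

End Generations.

(** * The mean number of stopped particles as a function of the start *)

Section MeanStopped.
Context {R : realType} (p : R).
Hypothesis hp : 0 < p < 1 / 2.
Local Notation h := (phat p).
Local Notation v := (mean_stopped p).

Lemma mean_stopped_ge0 q : (0 <= v q)%E.
Proof. by apply: nneseries_ge0 => n _ _; rewrite lee_fin iter_mean_step_ge0. Qed.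

Lemma mean_stopped_recl q : (v q = (at_origin q)%:E +
  \sum_(n <oo) (mean_step p (iter n (mean_step p) at_origin) q)%:E)%E.
Proof.
have ge0 k : (0 <= (iter k (mean_step p) at_origin q)%:E)%E.
  by rewrite lee_fin iter_mean_step_ge0.
rewrite /mean_stopped nneseries_recl// -nneseries_addn//.
by congr (_ + _)%E; apply: eq_eseriesr => n _; rewrite addn1.
Qed.

Lemma mean_stopped0 i : v (i, 0%N) = 1%E.
Proof. by rewrite mean_stopped_recl /at_origin eqxx eseries0 ?adde0. Qed.

Lemma mean_stoppedS i x : v (i, x.+1) =
  (\sum_(j < 3) (mean_offspring p i j)%:E * v (j, displace j x.+1))%E.
Proof.
rewrite mean_stopped_recl /at_origin/= add0e.
transitivity (\sum_(n <oo) \sum_(j < 3) (mean_offspring p i j)%:E *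
    (iter n (mean_step p) at_origin (j, displace j x.+1))%:E)%E.
  by apply: eq_eseriesr => n _; rewrite /mean_step/= -sumEFin.
rewrite nneseries_sum; last first.
  by move=> j n _; rewrite mule_ge0 ?lee_fin ?mean_offspring_ge0// iter_mean_step_ge0.
by apply: eq_bigr => j _; rewrite nneseriesZl// => n _; rewrite lee_fin iter_mean_step_ge0.
Qed.

(** [mean_stopped p] is the least nonnegative solution of its first-step
    equations: the sum of the first [N.+1] iterates is the indicator of site 0
    plus the operator applied to the sum of the first [N], which keeps it below
    [g]. *)
Lemma mean_stopped_le_supersolution (g : ptype * nat -> R) :
  (forall q, 0 <= g q) -> (forall i, 1 <= g (i, 0%N)) ->
  (forall q, mean_step p g q <= g q) -> forall q, (v q <= (g q)%:E)%E.
Proof.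
move=> g0 g1 gM q.
rewrite /mean_stopped; apply: lime_le.
  by apply: is_cvg_nneseries => n _ _; rewrite lee_fin iter_mean_step_ge0.
apply: nearW => N; rewrite sumEFin lee_fin.
elim: N q => [|N IHN] q; first by rewrite big_geq.
rewrite big_nat_recl//=; case: q => i [|x].
  by rewrite /at_origin eqxx big1 ?addr0.
rewrite {1}/at_origin/= add0r; apply: le_trans (gM _); rewrite /mean_step/=.
rewrite exchange_big/=; apply: ler_sum => j _.
by rewrite -mulr_sumr ler_wpM2l// mean_offspring_ge0.
Qed.

(** A Type-2 particle always has, in the mean, one child of Type 2 and one of
    Type 3, both to its right. *)
Lemma mean_stopped_type2 x :
  v (type2, x.+1) = (v (type2, x.+2) + v (type3, x.+2))%E.
Proof.
rewrite mean_stoppedS sum_ptype.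
have [-> -> ->] := mean_offspringE p type2.
by rewrite /= mul0e add0e !mul1e.
Qed.

(** With probability [1 - h], a particle of Type 1 or 3 reproduces exactly as
    one of Type 2 at the same site. *)
Lemma mean_stopped_type13 i x : i != type2 ->
  v (i, x.+1) = (h%:E * v (type1, x) + (1 - h)%:E * v (type2, x.+1))%E.
Proof.
move=> /negbTE i2; rewrite (mean_stopped_type2 x) (mean_stoppedS i) sum_ptype.
have [-> -> ->] := mean_offspringE p i; rewrite i2 /displace /= -addeA.
by rewrite muleDr ?ge0_adde_def// inE mean_stopped_ge0.
Qed.

Lemma mean_stopped_type3 x : v (type3, x.+1) = v (type1, x.+1).
Proof. by rewrite (@mean_stopped_type13 type3)// (@mean_stopped_type13 type1 x). Qed.

Lemma mean_stopped_gt0 x : (0 < v (type1, x))%E.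
Proof.
have /andP[h0 h1] := phat_bounds hp.
elim: x => [|x IHx]; first by rewrite mean_stopped0.
rewrite mean_stopped_type13//.
apply: (@lt_le_trans _ _ (h%:E * v (type1, x))%E); first by rewrite mule_gt0 ?lte_fin.
by rewrite leeDl// mule_ge0 ?mean_stopped_ge0// lee_fin subr_ge0 ltW.
Qed.

(** Finiteness spreads to the right: every type has with positive probability
    the offspring of Type 2, which lie one step to the right. *)
Lemma mean_stopped_finite i x : (v (i, x.+1) < +oo)%E ->
  forall y, (v (type1, y + x.+2)%N < +oo)%E /\ (v (type2, y + x.+2)%N < +oo)%E.
Proof.
have /andP[h0 h1] := phat_bounds hp.
have ge0 := mean_stopped_ge0.
have step z : (v (type2, z.+1) < +oo)%E ->
    (v (type1, z.+2) < +oo)%E /\ (v (type2, z.+2) < +oo)%E.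
  rewrite mean_stopped_type2 mean_stopped_type3 => lt; split; apply: le_lt_trans lt.
    by rewrite leeDr.
  by rewrite leeDl.
move=> vi; have v2 : (v (type2, x.+1) < +oo)%E.
  have [<-//|i2] := eqVneq i type2.
  move: vi; rewrite (mean_stopped_type13 _ i2) => lt.
  have : ((1 - h)%:E * v (type2, x.+1) < +oo)%E.
    by apply: le_lt_trans lt; rewrite leeDr// mule_ge0// lee_fin ltW.
  by apply: contraTT; rewrite -!leNgt !leye_eq => /eqP->;
    rewrite gt0_muley// lte_fin subr_gt0.
elim=> [|y [_ IHy]]; first exact: step.
by rewrite addSn !addnS in IHy *; exact: step.
Qed.

End MeanStopped.

(** * Positive solutions of the recurrence *)

Section Recurrence.
Context {R : realType}.

(** If [B < 2 s] with [s ^+ 2 = A * C], then by the inequality between the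
    arithmetic and geometric means [A * (a n.+1 / a n)] drops by at least
    [2 * s - B] at each step, so that the ratios become negative. *)
Lemma positive_recurrence_discriminant (A B C : R) (a : nat -> R) :
  0 < A -> 0 < C -> (forall n, 0 < a n) ->
  (forall n, A * a n.+2 - B * a n.+1 + C * a n = 0) ->
  0 < B /\ 4 * A * C <= B ^+ 2.
Proof.
move=> A0 C0 a0 rec; pose s := Num.sqrt (A * C).
have s0 : 0 < s by rewrite sqrtr_gt0 mulr_gt0.
have s2 : s ^+ 2 = A * C by rewrite sqr_sqrtr// ltW// mulr_gt0.
suff sB : 2 * s <= B.
  split; first by lra.
  by rewrite -mulrA -s2; nra.
rewrite leNgt; apply/negP => Bs; pose e := 2 * s - B.
have e0 : 0 < e by rewrite /e; lra.
pose K n := A * (a 1%N / a 0%N) - n%:R * e.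
have dec n : A * a n.+1 <= K n * a n.
  elim: n => [|n IHn].
    by rewrite /K mul0r subr0 -mulrA divfK// gt_eqF.
  have Kn : K n.+1 = K n - e by rewrite /K -natr1; ring.
  have := rec n; have := a0 n; have := a0 n.+1; have := a0 n.+2.
  move: IHn; rewrite Kn /e.
  move: (a n.+2) (a n.+1) (a n) (K n) => z y x k kx z0 y0 x0 eq0.
  suff : 2 * s * y <= k * y + C * x by lra.
  rewrite -(ler_pM2r x0) -(ler_pM2r A0).
  have : 0 <= (A * y - s * x) ^+ 2 by rewrite sqr_ge0.
  have : A * (A * y * y) <= A * (k * x * y).
    by rewrite ler_pM2l// ler_wpM2r// ltW.
  have -> : (A * y - s * x) ^+ 2 = A * (A * y * y) + s ^+ 2 * x ^+ 2 - 2 * s * A * y * x by ring.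
  rewrite s2.
  have -> : (k * y + C * x) * x * A = A * (k * x * y) + A * C * x ^+ 2 by ring.
  have -> : 2 * s * y * x * A = 2 * s * A * y * x by ring.
  lra.
pose n := (Num.trunc (A * (a 1%N / a 0%N) / e)).+1.
have Kn0 : K n <= 0.
  rewrite /K subr_le0 -ler_pdivrMr//; apply/ltW; exact: truncnS_gt.
have : 0 < K n * a n by apply: lt_le_trans (dec n); rewrite mulr_gt0.
by rewrite pmulr_lgt0// ltNge Kn0.
Qed.

(** The discriminant is [(1 - 5 * h) * (1 - h)], hence [h <= 1 / 5]; the larger
    root is then below 1. *)
Lemma characteristic_root (h : R) : 0 < h < 1 -> 4 * (2 - h) * h <= (1 + h) ^+ 2 ->
  exists mu : R, [/\ 0 < mu, mu < 1 & (2 - h) * mu ^+ 2 - (1 + h) * mu + h = 0].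
Proof.
move=> /andP[h0 h1] disc; pose D := (1 + h) ^+ 2 - 4 * (2 - h) * h.
have D0 : 0 <= D by rewrite subr_ge0.
have s0 := sqrtr_ge0 D; have s2 := sqr_sqrtr D0.
have h15 : 5 * h <= 1 by move: disc; nra.
have s1 : Num.sqrt D <= 1.
  by rewrite -(@ler_pXn2r _ 2)// ?nnegrE// s2 expr1n /D; nra.
move: s0 s2 s1; set s := Num.sqrt D => s0 s2 s1.
exists ((1 + h + s) / (2 * (2 - h))).
have q0 : 0 < 2 * (2 - h) by lra.
split; first by rewrite divr_gt0//; lra.
  by rewrite ltr_pdivrMr//; lra.
have -> : (2 - h) * ((1 + h + s) / (2 * (2 - h))) ^+ 2 -
    (1 + h) * ((1 + h + s) / (2 * (2 - h))) + h =
    (s ^+ 2 - D) / (4 * (2 - h)) by rewrite /D; field; lra.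
by rewrite s2 subrr mul0r.
Qed.

End Recurrence.

(** * The criterion *)

Section Criterion.
Context {R : realType} (p : R).
Hypothesis hp : 0 < p < 1 / 2.

Lemma expr_displace (mu : R) j x : 0 < mu ->
  mu ^+ displace j x.+1 =
  mu ^+ x.+1 * (left_prob R j * (1 / mu) + right_prob R j * mu).
Proof.
move=> mu0; have mu_neq0 : mu != 0 by rewrite gt_eqF.
move: j; apply: ptypeP; rewrite /displace /left_prob /right_prob /= ?exprS; field.
all: by [].
Qed.

(** The supersolution is [S * alpha i * mu ^+ x], where the constant [S], the
    sum of the inverses of the [alpha j], makes it at least 1 at site 0. *)
Lemma mean_stopped_finite_of_supersolution (mu : R) (alpha : ptype -> R) :
  0 < mu -> (forall i, 0 < alpha i) ->
  (forall i : ptype, \sum_(j < 3) mean_offspring p i j * alpha j *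
     (left_prob R j * (1 / mu) + right_prob R j * mu) <= alpha i) ->
  forall q, (mean_stopped p q < +oo)%E.
Proof.
move=> mu0 a0 ineq q.
pose S := \sum_(j < 3) (alpha j)^-1.
pose g (q : ptype * nat) := S * (alpha q.1 * mu ^+ q.2).
have S0 : 0 <= S by apply: sumr_ge0 => j _; rewrite invr_ge0 ltW.
apply: (@le_lt_trans _ _ (g q)%:E); last exact: ltry.
apply: mean_stopped_le_supersolution => //.
- by move=> r; rewrite /g !mulr_ge0// ?exprn_ge0// ltW.
- move=> i; rewrite /g /= expr0 mulr1 mulr_suml (bigD1 i)//= mulVf ?gt_eqF//.
  by rewrite lerDl sumr_ge0// => j _; rewrite mulr_ge0 ?invr_ge0// ltW.
- move=> [i [|x]]; rewrite /mean_step/= /g/=; first by rewrite !mulr_ge0// ltW.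
  rewrite (mulrC (alpha i)) mulrA.
  apply: le_trans (_ : S * mu ^+ x.+1 * \sum_(j < 3) mean_offspring p i j * alpha j *
     (left_prob R j * (1 / mu) + right_prob R j * mu) <= _).
    rewrite mulr_sumr; apply: ler_sum => j _; rewrite expr_displace//.
    by rewrite le_eqVlt; apply/orP; left; apply/eqP; ring.
  by rewrite ler_wpM2l// mulr_ge0// exprn_ge0// ltW.
Qed.

(** Eliminating the Type-2 values [b] from the first-step equations leaves a
    recurrence of order two for the positive Type-1 values [a]. *)
Lemma phat_critical i x : (mean_stopped p (i, x.+1) < +oo)%E ->
  4 * (2 - phat p) * phat p <= (1 + phat p) ^+ 2.
Proof.
have /andP[h0 h1] := phat_bounds hp => /(mean_stopped_finite hp) fin.
have fineE q : (mean_stopped p q < +oo)%E ->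
    mean_stopped p q = (fine (mean_stopped p q))%:E.
  by move=> lt; rewrite fineK// ge0_fin_numE// mean_stopped_ge0.
pose a n := fine (mean_stopped p (type1, n + x.+2)%N).
pose b n := fine (mean_stopped p (type2, n + x.+2)%N).
have Ea n : mean_stopped p (type1, n + x.+2)%N = (a n)%:E.
  by apply: fineE; have [] := fin n.
have Eb n : mean_stopped p (type2, n + x.+2)%N = (b n)%:E.
  by apply: fineE; have [] := fin n.
have ab n : a n.+1 = phat p * a n + (1 - phat p) * b n.+1.
  apply: EFin_inj; rewrite -Ea addSn mean_stopped_type13// Ea -addSn Eb.
  by rewrite -!EFinM -EFinD.
have bb n : b n = b n.+1 + a n.+1.
  apply: EFin_inj; rewrite -Eb addnS (mean_stopped_type2 hp) EFinD -Ea -Eb.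
  by rewrite !addSn !addnS mean_stopped_type3.
have [||n|n|_] := @positive_recurrence_discriminant R (2 - phat p) (1 + phat p) (phat p) a.
- by lra.
- by [].
- by rewrite -lte_fin -Ea mean_stopped_gt0.
- have := ab n; have := ab n.+1; have := bb n.+1; move: (b n.+1) (b n.+2).
  move: (a n) (a n.+1) (a n.+2) => u v w b1 b2 -> e1 e2.
  by move: e1 e2; rewrite mulrDr; lra.
- by [].
Qed.

(** Types 1 and 3 have the same mean offspring, so that equality forces
    [alpha type1 = alpha type3]; equality for Type 2 then forces [alpha] to be
    proportional to [(1 - mu, mu, 1 - mu)], and what remains is the quadratic
    equation for [mu]. *)
Lemma exact_solution (mu : R) : 0 < mu ->
  (2 - phat p) * mu ^+ 2 - (1 + phat p) * mu + phat p = 0 ->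
  let alpha (i : ptype) := if i == type2 then mu else 1 - mu in
  forall i : ptype, \sum_(j < 3) mean_offspring p i j * alpha j *
     (left_prob R j * (1 / mu) + right_prob R j * mu) = alpha i.
Proof.
move=> mu0 root alpha; have mu_neq0 : mu != 0 by rewrite gt_eqF.
have hmu : phat p / mu = (1 + phat p) - (2 - phat p) * mu.
  by apply: (mulIf mu_neq0); rewrite divfK//; lra.
move=> i; rewrite sum_ptype /alpha /left_prob /right_prob /=.
have [-> -> ->] := mean_offspringE p i; case: ifP => _; first by ring.
transitivity (phat p / mu * (1 - mu) + (1 - phat p) * mu); first by ring.
by rewrite hmu; lra.
Qed.

End Criterion.

Theorem lemma14 (R : realType) (p : R) (hp : 0 < p < 1 / 2)
    (d : measure_display) (T : measurableType d) (P : probability T R)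
    (xi : label * ptype -> T -> offspring)
    (hxi : is_nbBRW_offspring p P xi)
    (init : seq (ptype * nat)) :
  ((exists (mu : R) (alpha : ptype -> R),
      [/\ 0 < mu, forall i, 0 < alpha i
        & forall i : ptype,
            \sum_(j < 3) mean_offspring p i j * alpha j *
              (left_prob R j * (1 / mu) + right_prob R j * mu) <= alpha i]) ->
    (\int[P]_w V_nbBRW R init xi w < +oo)%E) /\
  ((exists2 q, q \in init & q.2 != 0%N) ->
    (\int[P]_w V_nbBRW R init xi w < +oo)%E ->
    exists (mu : R) (alpha : ptype -> R),
      [/\ 0 < mu, forall i, 0 < alpha i
        & forall i : ptype,
            \sum_(j < 3) mean_offspring p i j * alpha j *
              (left_prob R j * (1 / mu) + right_prob R j * mu) = alpha i]).
Proof.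
rewrite (mean_V hp hxi); split=> [[mu [alpha [mu0 a0 ineq]]]|].
  apply: lte_sum_pinfty => q _.
  exact: mean_stopped_finite_of_supersolution ineq q.
move=> [[i [//|x]] qinit _]; rewrite (big_rem _ qinit)/= => sum_fin.
have vfin : (mean_stopped p (i, x.+1) < +oo)%E.
  apply: le_lt_trans sum_fin; rewrite leeDl// sume_ge0// => q _.
  exact: mean_stopped_ge0.
have [mu [mu0 mu1 root]] := characteristic_root (phat_bounds hp) (phat_critical hp vfin).
exists mu, (fun i => if i == type2 then mu else 1 - mu); split=> //.
  by move=> j; case: ifP => // _; rewrite subr_gt0.
exact: exact_solution.
Qed.
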